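(* Every (convex) hexagon in $\mathbb{R}^2$, i.e. every polygon with exactly six vertices, has psd rank exactly $4$.
   Context: Let $\mathcal{S}_+^k$ be the cone of real symmetric positive semidefinite $k\times k$ matrices. The psd rank of an entrywise nonnegative $p\times q$ matrix $M$ is the smallest $k$ such that there are $A_1,\dots,A_p,B_1,\dots,B_q\in\mathcal{S}_+^k$ with $M_{ij}=\mathrm{Trace}(A_iB_j)$ for all $i,j$. The psd rank of a full-dimensional polytope $P\subset\mathbb{R}^n$ with vertices $p_1,\dots,p_v$ and facet-defining inequalities $d_j - c_j^T x \ge 0$ ($j=1,\dots,f$) is the psd rank of its slack matrix, the $v\times f$ nonnegative matrix with $(i,j)$ entry $d_j - c_j^T p_i$. (It is known that this equals the smallest $k$ such that $P$ is a linear image of the intersection of $\mathcal{S}_+^k$ with an affine subspace of the space of symmetric $k\times k$ matrices.) *)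

(* Defs.v *)
From HB Require Import structures.
From mathcomp Require Import all_boot all_order all_algebra.
From mathcomp Require Import boolp classical_sets functions cardinality reals.

Set Implicit Arguments.
Unset Strict Implicit.
Unset Printing Implicit Defensive.

Import Order.TTheory GRing.Theory Num.Theory.
Local Open Scope classical_set_scope.
Local Open Scope ring_scope.

Definition psdmx (R : realType) (k : nat) (A : 'M[R]_k) : Prop :=
  A^T = A /\ forall x : 'rV[R]_k, 0 <= (x *m A *m x^T) 0 0.

Definition psd_factorization (R : realType) (p q : nat) (M : 'M[R]_(p, q))
    (k : nat) : Prop :=
  exists (A : 'I_p -> 'M[R]_k) (B : 'I_q -> 'M[R]_k),
    [/\ forall i, psdmx (A i),
        forall j, psdmx (B j)
      & forall i j, M i j = \tr (A i *m B j)].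

Definition is_psd_rank (R : realType) (p q : nat) (M : 'M[R]_(p, q))
    (k : nat) : Prop :=
  psd_factorization M k /\ forall l, psd_factorization M l -> (k <= l)%N.

Definition dotr (R : realType) (n : nat) (c x : 'rV[R]_n) : R :=
  \sum_(i < n) c 0 i * x 0 i.

Definition conv_hull (R : realType) (n m : nat) (s : 'I_m -> 'rV[R]_n) :
    set 'rV[R]_n :=
  [set x | exists w : 'I_m -> R,
    [/\ forall i, 0 <= w i, \sum_i w i = 1 & x = \sum_i w i *: s i]].

Definition polytope (R : realType) (n : nat) (P : set 'rV[R]_n) : Prop :=
  exists (m : nat) (s : 'I_m -> 'rV[R]_n), P = conv_hull s.

Definition vertices (R : realType) (n : nat) (P : set 'rV[R]_n) :
    set 'rV[R]_n :=
  [set x | P x /\ forall (y z : 'rV[R]_n) (t : R), P y -> P z ->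
    0 < t -> t < 1 -> x = t *: y + (1 - t) *: z -> y = x /\ z = x].

Definition affinely_independent (R : realType) (n m : nat)
    (s : 'I_m -> 'rV[R]_n) : Prop :=
  forall a : 'I_m -> R,
    \sum_i a i = 0 -> \sum_i a i *: s i = 0 -> forall i, a i = 0.

Definition has_aff_indep (R : realType) (n : nat) (A : set 'rV[R]_n)
    (m : nat) : Prop :=
  exists s : 'I_m -> 'rV[R]_n, (forall i, A (s i)) /\ affinely_independent s.

(* The affine hull of [A] has dimension [d]: the largest affinely independent
   families in [A] have d + 1 points. *)
Definition aff_dim (R : realType) (n : nat) (A : set 'rV[R]_n) (d : nat) :
    Prop :=
  has_aff_indep A d.+1 /\ ~ has_aff_indep A d.+2.

Definition full_dimensional (R : realType) (n : nat) (P : set 'rV[R]_n) :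
    Prop :=
  aff_dim P n.

Definition valid_ineq (R : realType) (n : nat) (P : set 'rV[R]_n)
    (c : 'rV[R]_n) (d : R) : Prop :=
  forall x, P x -> 0 <= d - dotr c x.

Definition face_of (R : realType) (n : nat) (P : set 'rV[R]_n)
    (c : 'rV[R]_n) (d : R) : set 'rV[R]_n :=
  [set x | P x /\ d - dotr c x = 0].

Definition facet_ineq (R : realType) (n : nat) (P : set 'rV[R]_n)
    (c : 'rV[R]_n) (d : R) : Prop :=
  valid_ineq P c d /\ exists e, aff_dim P e.+1 /\ aff_dim (face_of P c d) e.

Definition facet (R : realType) (n : nat) (P F : set 'rV[R]_n) : Prop :=
  exists (c : 'rV[R]_n) (d : R), facet_ineq P c d /\ F = face_of P c d.

(* [v] lists the vertices of [P] without repetition, and the inequalities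
   [d j - c j . x >= 0] list its facets, exactly one inequality per facet. *)
Definition slack_matrix (R : realType) (n : nat) (P : set 'rV[R]_n)
    (p q : nat) (M : 'M[R]_(p, q)) : Prop :=
  exists (v : 'I_p -> 'rV[R]_n) (c : 'I_q -> 'rV[R]_n) (d : 'I_q -> R),
    [/\ injective v /\ range v = vertices P,
        forall j, facet_ineq P (c j) (d j),
        forall F, facet P F -> exists! j, F = face_of P (c j) (d j)
      & forall i j, M i j = d j - dotr (c j) (v i)].

(* A slack matrix is determined only up to the order of its rows and columns
   and positive scaling of its columns. The psd rank is required to be [k] for
   every choice, and the existence of a slack matrix is required so that this
   is never vacuous. *)
Definition polytope_psd_rank (R : realType) (n : nat) (P : set 'rV[R]_n)
    (k : nat) : Prop :=
  (exists (p q : nat) (M : 'M[R]_(p, q)), slack_matrix P M) /\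
  forall (p q : nat) (M : 'M[R]_(p, q)), slack_matrix P M -> is_psd_rank M k.

(* Main.v *)
(* Lower bound: in a factorization of size at most 3 orthogonality of consecutive
   factors forces all of them to have rank one, so the slack matrix has an
   entrywise square root of rank at most 3. Both matrices then have a vanishing
   4 x 4 minor with only three nonzero terms, which is impossible.

   Upper bound: lift the hexagon p0 ... p5 to an octahedron in space by moving p2
   above and p5 below the plane of p0, p1, p3, p4, so that the segment p2 p5 meets
   the segment p0 p3. The slack matrix of this octahedron has an entrywise square
   root of rank 4, and every edge inequality of the hexagon is a nonnegative
   combination of two facet inequalities of the octahedron. *)
Require Import Defs.
From HB Require Import structures.
From mathcomp Require Import all_boot all_order all_algebra.
From mathcomp Require Import boolp classical_sets functions cardinality reals.
From mathcomp Require Import ring lra.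

Set Implicit Arguments.
Unset Strict Implicit.
Unset Printing Implicit Defensive.

Import Order.TTheory GRing.Theory Num.Theory.
Local Open Scope classical_set_scope.
Local Open Scope ring_scope.

(** Each facet of the octahedron contains exactly one of p0 and p3. As the axis meets the diagonal
    p0 p3, the slack of an apex on a facet that misses it is a multiple of the slack of a single
    base vertex, p0 or p3. The root of such an entry is a product, never the root of a sum, and this
    keeps the rank at 4. Homogeneous weights turn the base into a unit square, whose slacks 0 and 1
    are their own roots. An edge of the hexagon is also an edge of the octahedron, and the vertical
    plane through it supports the octahedron; hence the combination of the two facets that meet
    there.

    The polygon is given only as a polytope with six extreme points: a cyclic labelling of the
    vertices and the matching of facets with edges have to be constructed. *)

(** * Positive semidefinite matrices: kernels, Gram sums, rank one *)

Lemma psdmx_bilinC (R : realType) (k : nat) (A : 'M[R]_k) (x y : 'rV[R]_k) :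
  A^T = A -> (y *m A *m x^T) 0 0 = (x *m A *m y^T) 0 0.
Proof.
move=> symA; have <- : (y *m A *m x^T)^T = x *m A *m y^T.
  by rewrite !trmx_mul trmxK symA mulmxA.
by rewrite [RHS]mxE.
Qed.

Lemma psdmx_quadD (R : realType) (k : nat) (A : 'M[R]_k) (x y : 'rV[R]_k)
    (t : R) : A^T = A ->
  ((y + t *: x) *m A *m (y + t *: x)^T) 0 0
  = (y *m A *m y^T) 0 0 + 2 * t * (x *m A *m y^T) 0 0
    + t ^+ 2 * (x *m A *m x^T) 0 0.
Proof.
move=> symA; rewrite linearD linearZ /= !mulmxDl !mulmxDr -!scalemxAl -!scalemxAr.
rewrite !mxE.
have := psdmx_bilinC x y symA; rewrite !mxE => ->.
ring.
Qed.

(** On the line [y + t *: x] the form is affine in [t] with slope [2 * b]; were [b] nonzero, a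
    suitable [t] would bring its value to -1. *)
Lemma psdmx_ker (R : realType) (k : nat) (A : 'M[R]_k) (x : 'rV[R]_k) :
  psdmx A -> (x *m A *m x^T) 0 0 = 0 -> x *m A = 0.
Proof.
move=> [symA psdA] qx0; apply/rowP => j; rewrite [RHS]mxE.
pose y : 'rV[R]_k := delta_mx 0 j.
have -> : (x *m A) 0 j = (x *m A *m y^T) 0 0.
  by rewrite /y trmx_delta -colE [RHS]mxE.
set b := _ 0 0; apply/eqP; apply: contraT => b0.
have := psdA (y + (- ((y *m A *m y^T) 0 0 + 1) / (2 * b)) *: x).
rewrite psdmx_quadD // qx0 -/b.
set c := (y *m A *m y^T) 0 0.
have -> : c + 2 * (- (c + 1) / (2 * b)) * b + (- (c + 1) / (2 * b)) ^+ 2 * 0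
   = -1 by field; rewrite b0.
by rewrite oppr_ge0 ler10.
Qed.

Lemma psdmx_diag_ge0 (R : realType) (k : nat) (A : 'M[R]_k) (i : 'I_k) :
  psdmx A -> 0 <= A i i.
Proof.
case=> _ /(_ (delta_mx 0 i)); rewrite trmx_delta -rowE -colE.
by rewrite !mxE.
Qed.

Lemma psdmx_sumD (R : realType) (k : nat) (A B : 'M[R]_k) :
  psdmx A -> psdmx B -> psdmx (A + B).
Proof.
move=> [sA pA] [sB pB]; split; first by rewrite linearD /= sA sB.
by move=> x; rewrite mulmxDr mulmxDl mxE addr_ge0.
Qed.

Lemma psdmxZ (R : realType) (k : nat) (A : 'M[R]_k) (c : R) :
  0 <= c -> psdmx A -> psdmx (c *: A).
Proof.
move=> c0 [sA pA]; split; first by rewrite linearZ /= sA.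
by move=> x; rewrite -scalemxAr -scalemxAl mxE mulr_ge0.
Qed.

Lemma quad_rank1 (R : realType) (k : nat) (a x : 'rV[R]_k) :
  (x *m (a^T *m a) *m x^T) 0 0 = ((x *m a^T) 0 0) ^+ 2.
Proof.
rewrite mulmxA -[x *m a^T *m a *m _]mulmxA.
have -> : a *m x^T = (x *m a^T)^T by rewrite trmx_mul trmxK.
by rewrite mxE big_ord1 [X in _ * X]mxE expr2.
Qed.

Lemma psdmx_rank1 (R : realType) (k : nat) (a : 'rV[R]_k) : psdmx (a^T *m a).
Proof.
split; first by rewrite trmx_mul trmxK.
by move=> x; rewrite quad_rank1 sqr_ge0.
Qed.

(* One step of Cholesky: subtracting [(row i A)^T (row i A) / A i i] kills the
   i-th row and keeps the matrix positive semidefinite. *)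
Lemma psdmx_gram (R : realType) (k : nat) (A : 'M[R]_k) :
  psdmx A -> exists s : seq 'rV[R]_k, A = \sum_(x <- s) x^T *m x.
Proof.
(* Induction on the number of nonzero diagonal entries: one is cleared, none is revived. *)
have [n] := ubnP #|[pred i | A i i != 0]|; elim: n A => // n IHn A leAn psdA.
have [/existsP[i Aii0]|] := boolP [exists i, A i i != 0]; last first.
  move=> /existsPn diag0; exists [::]; rewrite big_nil.
  apply/row_matrixP => i; rewrite row0 rowE; apply: psdmx_ker => //.
  rewrite trmx_delta -rowE -colE !mxE.
  by apply/eqP; have := diag0 i; rewrite negbK.
have [symA pA] := psdA.
have Aii : 0 < A i i by rewrite lt_def Aii0 psdmx_diag_ge0.
pose a := row i A.
have aE j : a 0 j = A i j by rewrite mxE.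
pose B := A - (A i i)^-1 *: (a^T *m a).
have BE j : B j j = A j j - (A i i)^-1 * A i j ^+ 2.
  by rewrite !mxE big_ord1 !mxE expr2.
have psdB : psdmx B.
  split.
    by rewrite linearB linearZ /= symA trmx_mul trmxK.
  move=> x; set b := (x *m a^T) 0 0.
  pose e : 'rV[R]_k := delta_mx 0 i.
  have bE : (e *m A *m x^T) 0 0 = b.
    by rewrite psdmx_bilinC // /e trmx_delta /b /a tr_row symA colE mulmxA.
  have eE : (e *m A *m e^T) 0 0 = A i i.
    by rewrite /e trmx_delta -colE -rowE !mxE.
  (* This shift of [x] along [e] minimizes the form of [A]; the minimum is the value of the form of
     [B] at [x]. *)
  have := pA (x + (- b / A i i) *: e).
  rewrite psdmx_quadD // bE eE.
  have -> : (x *m B *m x^T) 0 0 = (x *m A *m x^T) 0 0 - (A i i)^-1 * b ^+ 2.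
    rewrite mulmxBr mulmxBl -scalemxAr -scalemxAl -quad_rank1.
    by rewrite [LHS]mxE [X in _ + X]mxE [X in _ - X]mxE.
  suff -> : (x *m A *m x^T) 0 0 - (A i i)^-1 * b ^+ 2 =
    (x *m A *m x^T) 0 0 + 2 * (- b / A i i) * b + (- b / A i i) ^+ 2 * A i i.
    by [].
  by field.
have [s Bs] : exists s : seq 'rV[R]_k, B = \sum_(x <- s) x^T *m x.
  apply: (IHn _ _ psdB); rewrite ltnS in leAn; apply: leq_trans leAn.
  apply: proper_card; apply/properP; split.
    apply/fintype.subsetP => j; rewrite !inE; apply: contra => /eqP Ajj0.
    have := psdmx_diag_ge0 j psdB; rewrite BE Ajj0 sub0r oppr_ge0 => le0.
    by rewrite oppr_eq0 eq_le le0 mulr_ge0 ?invr_ge0 ?sqr_ge0 // ltW.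
  exists i; rewrite !inE // negbK BE; apply/eqP; field.
  by [].
exists ((Num.sqrt (A i i)^-1 *: a) :: s); rewrite big_cons -Bs.
rewrite -scalemxAr [X in X *m _]linearZ /= -scalemxAl scalerA -expr2.
rewrite sqr_sqrtr ?invr_ge0 ?ltW //.
by rewrite /B addrC subrK.
Qed.

(** A Gram sum for [B] turns the trace into a sum of values of the form of [A]. All of them vanish,
    and [psdmx_ker] applies to each vector. *)
Lemma psdmx_mul_eq0 (R : realType) (k : nat) (A B : 'M[R]_k) :
  psdmx A -> psdmx B -> \tr (A *m B) = 0 -> A *m B = 0.
Proof.
move=> psdA /psdmx_gram[s ->]; have [symA pA] := psdA.
have trE (x : 'rV[R]_k) : \tr (A *m (x^T *m x)) = (x *m A *m x^T) 0 0.
  by rewrite mulmxA mxtrace_mulC mulmxA trace_mx11.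
rewrite mulmx_sumr raddf_sum /= => /eqP; rewrite psumr_eq0; last first.
  by move=> x _; rewrite trE pA.
move=> /allP tr0; rewrite big_seq big1 // => x /tr0; rewrite trE => /eqP qx0.
have xA0 := psdmx_ker psdA qx0.
by rewrite mulmxA -[A *m x^T]trmxK trmx_mul trmxK symA xA0 trmx0 mul0mx.
Qed.

Lemma psdmx_mulC0 (R : realType) (k : nat) (A B : 'M[R]_k) :
  psdmx A -> psdmx B -> A *m B = 0 -> B *m A = 0.
Proof. by move=> [sA _] [sB _] AB0; rewrite -sA -sB -trmx_mul AB0 trmx0. Qed.

(** Inclusion of row spaces is reverse inclusion of kernels: on a vector killed by [A + B], the two
    nonnegative forms have sum zero, so [A] kills it too. *)
Lemma psdmx_submxD (R : realType) (k : nat) (A B : 'M[R]_k) :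
  psdmx A -> psdmx B -> (A <= (A + B)%R)%MS.
Proof.
move=> psdA psdB; have [symA pA] := psdA; have [_ pB] := psdB.
rewrite submxE; apply/eqP; apply: trmx_inj.
rewrite trmx_mul symA trmx0; apply/row_matrixP => i; rewrite row_mul row0.
set x := row i _; apply: psdmx_ker => //.
have : (x *m (A + B) *m x^T) 0 0 = 0.
  rewrite /x tr_row trmxK colE -mulmxA [(A + B) *m _]mulmxA mulmx_coker mul0mx mulmx0.
  by rewrite mxE.
rewrite mulmxDr mulmxDl mxE => /eqP.
by rewrite paddr_eq0 // => /andP[/eqP].
Qed.

(* The column space of [B1 + B2] is orthogonal to the rows of [A] and contains
   those of [B1] and [B2], which are not proportional because [C] kills [B1] but
   not [B2]. *)
Lemma psdmx_rank_le1 (R : realType) (k : nat) (A B1 B2 C : 'M[R]_k) :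
    (k <= 3)%N -> psdmx A -> psdmx B1 -> psdmx B2 ->
    A *m B1 = 0 -> A *m B2 = 0 -> B1 *m C = 0 -> B2 *m C != 0 -> B1 != 0 ->
  (\rank A <= 1)%N.
Proof.
move=> k3 pA pB1 pB2 AB1 AB2 B1C B2C B1n0.
have rB : (1 < \rank (B1 + B2)%R)%N.
  rewrite ltnNge; apply: contra B2C => rD.
  have B1D := psdmx_submxD pB1 pB2.
  have B2D : (B2 <= (B1 + B2)%R)%MS by rewrite addrC psdmx_submxD.
  have DB1 : ((B1 + B2)%R <= B1)%MS.
    have [_ <-] := mxrank_leqif_sup B1D.
    rewrite eqn_leq mxrankS //=; apply: leq_trans rD _.
    by rewrite lt0n mxrank_eq0.
  have /submxP[Y ->] := submx_trans B2D DB1.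
  by rewrite -mulmxA B1C mulmx0.
have : A *m (B1 + B2) = 0 by rewrite mulmxDr AB1 AB2 addr0.
move=> /mulmx0_rank_max rAB.
rewrite -(leq_add2r 2); apply: leq_trans k3; apply: leq_trans rAB.
by rewrite leq_add2l.
Qed.

(** All 2 x 2 minors vanish, so the row of a nonzero diagonal entry determines [A]. If the diagonal
    is zero, they give [A i j ^+ 2 = A i i * A j j = 0]. *)
Lemma psdmx_rank1P (R : realType) (k : nat) (A : 'M[R]_k) :
  psdmx A -> (\rank A <= 1)%N -> exists a : 'rV[R]_k, A = a^T *m a.
Proof.
move=> psdA rA; have [symA pA] := psdA.
have minor i j l m : A i j * A l m = A i m * A l j.
  rewrite -[A](mulmx_base A); move: (col_base A) (row_base A).
  case: (\rank A) rA => [|[|//]] _ C D; first by rewrite !mxE !big_ord0 mul0r.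
  by rewrite !mxE !big_ord1; ring.
have [/existsP[i Aii0]|] := boolP [exists i, A i i != 0]; last first.
  move=> /existsPn diag0; exists 0; rewrite mulmx0.
  apply/matrixP => i j; rewrite mxE; apply/eqP; rewrite -sqrf_eq0 expr2.
  have sE : A i j = A j i by rewrite -[in LHS]symA mxE.
  have := diag0 i; rewrite negbK => /eqP Aii.
  by rewrite {2}sE minor Aii mul0r.
have Aii : 0 < A i i by rewrite lt_def Aii0 psdmx_diag_ge0.
exists ((Num.sqrt (A i i))^-1 *: row i A).
rewrite -scalemxAr [X in X *m _]linearZ /= -scalemxAl scalerA -expr2 exprVn.
rewrite sqr_sqrtr ?ltW //; apply/matrixP => j l.
rewrite !mxE big_ord1 !mxE.
have -> : A i j = A j i by rewrite -[in LHS]symA mxE.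
by rewrite minor mulrCA mulrA mulrC; field.
Qed.

Lemma sqr_trace_rank1 (R : realType) (k : nat) (a b : 'rV[R]_k) :
  \tr (a^T *m a *m (b^T *m b)) = ((a *m b^T) 0 0) ^+ 2.
Proof.
rewrite [a^T *m a *m _]mulmxA mxtrace_mulC !mulmxA trace_mx11.
rewrite -[b *m a^T *m a]mulmxA quad_rank1.
have <- : (a *m b^T)^T = b *m a^T by rewrite trmx_mul trmxK.
by rewrite [in LHS]mxE.
Qed.

(** * Oriented triangles and the slacks of a convex hexagon *)

Definition orient (R : realType) (u v w : 'rV[R]_2) : R :=
  (v 0 0 - u 0 0) * (w 0 1 - u 0 1) - (v 0 1 - u 0 1) * (w 0 0 - u 0 0).

(* Abstracting the coordinates spares [ring] the comparison of the indices [0]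
   and [1] of ['I_2] up to conversion. *)
Ltac coords := rewrite /orient;
  repeat match goal with |- context [fun_of_matrix ?M ?i ?j] =>
    generalize (fun_of_matrix M i j); intro end.

Lemma orient_rot (R : realType) (u v w : 'rV[R]_2) :
  orient u v w = orient v w u.
Proof. by coords; ring. Qed.

Lemma orient_swap (R : realType) (u v w : 'rV[R]_2) :
  orient v u w = - orient u v w.
Proof. by coords; ring. Qed.

Lemma orient_eql (R : realType) (u v : 'rV[R]_2) : orient u v u = 0.
Proof. by coords; ring. Qed.

Lemma orient_eqr (R : realType) (u v : 'rV[R]_2) : orient u v v = 0.
Proof. by coords; ring. Qed.

Definition tri (R : realType) (q : nat -> 'rV[R]_2) (i j k : nat) : R :=
  orient (q i) (q j) (q k).

(** Asking this of all triples, not only of consecutive ones, excludes sequences that wind around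
    twice. Indices in [nat] with explicit bounds let case analysis compute. *)
Definition ccw_hexagon (R : realType) (q : nat -> 'rV[R]_2) : Prop :=
  forall i j k, (i < j)%N -> (j < k)%N -> (k < 6)%N -> 0 < tri q i j k.

Definition next6 (j : nat) : nat := if j is 5 then 0%N else j.+1.

(** The edge comes first and the vertex second, the reverse of the order in a slack matrix. *)
Definition hex_slack (R : realType) (q : nat -> 'rV[R]_2) (j i : nat) : R :=
  tri q j (next6 j) i.

Lemma next6_lt j : (j < 6)%N -> (next6 j < 6)%N.
Proof. by case: j => [|[|[|[|[|[|j]]]]]]. Qed.

Lemma hex_slack_gt0 (R : realType) (q : nat -> 'rV[R]_2) (j i : nat) :
  ccw_hexagon q -> (j < 6)%N -> (i < 6)%N -> i != j -> i != next6 j ->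
  0 < hex_slack q j i.
Proof.
move=> cq j6 i6 ij inj; rewrite /hex_slack /tri.
have [jE|j5] := eqVneq j 5.
  subst j; rewrite /= orient_rot; apply: cq => //; first by rewrite lt0n.
  by rewrite ltn_neqAle ij -ltnS.
have nj : next6 j = j.+1 by case: (j) j5 => [|[|[|[|[|[|]]]]]].
rewrite nj in inj *; have [ltij|ltji|/eqP] := ltngtP i j; last by rewrite (negPf ij).
  rewrite -orient_rot; apply: cq => //.
  by rewrite -nj next6_lt.
by apply: cq => //; rewrite ltn_neqAle eq_sym inj.
Qed.

Lemma hex_slack_start (R : realType) (q : nat -> 'rV[R]_2) (j : nat) :
  hex_slack q j j = 0.
Proof. exact: orient_eql. Qed.

Lemma hex_slack_end (R : realType) (q : nat -> 'rV[R]_2) (j : nat) :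
  hex_slack q j (next6 j) = 0.
Proof. exact: orient_eqr. Qed.

(** * Lower bound *)

(** Affine functions on the plane form a space of dimension three, so the minor on vertices and
    edges 0 to 3 is zero; its seven incidences leave three of the 24 terms. *)
Lemma hex_slack_minor (R : realType) (q : nat -> 'rV[R]_2) :
  hex_slack q 3 1 * hex_slack q 0 2 * hex_slack q 2 0 * hex_slack q 1 3 =
  hex_slack q 2 1 * hex_slack q 0 2 * hex_slack q 3 0 * hex_slack q 1 3 +
  hex_slack q 2 1 * hex_slack q 3 2 * hex_slack q 0 3 * hex_slack q 1 0.
Proof. by rewrite /hex_slack /tri /=; coords; ring. Qed.

(** Factoring through dimension at most 3 makes the determinant zero. The prescribed zeros are the
    incidences behind [hex_slack_minor], so the same three terms survive. *)
Lemma det4_dot (R : realType) (l : nat) (a b : nat -> 'rV[R]_l)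
    (h : nat -> nat -> R) : (l <= 3)%N ->
  (forall i j, h i j = (a i *m (b j)^T) 0 0) ->
  h 0%N 0%N = 0 -> h 1%N 1%N = 0 -> h 2%N 2%N = 0 -> h 3%N 3%N = 0 ->
  h 1%N 0%N = 0 -> h 2%N 1%N = 0 -> h 3%N 2%N = 0 ->
  h 1%N 3%N * h 2%N 0%N * h 0%N 2%N * h 3%N 1%N =
  h 1%N 2%N * h 2%N 0%N * h 0%N 3%N * h 3%N 1%N + h 1%N 2%N * h 2%N 3%N * h 3%N 0%N * h 0%N 1%N.
Proof.
move=> l3 hE h00 h11 h22 h33 h10 h21 h32.
pose d3 (x : nat -> nat -> R) i j k := 
  x i 1%N * (x j 2%N * x k 3%N - x j 3%N * x k 2%N)
  - x i 2%N * (x j 1%N * x k 3%N - x j 3%N * x k 1%N)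
  + x i 3%N * (x j 1%N * x k 2%N - x j 2%N * x k 1%N).
have det0 : h 0%N 0%N * d3 h 1%N 2%N 3 - h 1%N 0%N * d3 h 0%N 2%N 3 + h 2%N 0%N * d3 h 0%N 1%N 3
    - h 3%N 0%N * d3 h 0%N 1%N 2 = 0.
  rewrite /d3 !hE !mxE.
  case: l a b l3 {hE} => [|[|[|[|//]]]] a b _;
    rewrite ?big_ord_recl ?big_ord0; ring.
move: det0; rewrite /d3 h00 h11 h22 h33 h10 h21 h32 => det0.
apply/eqP; rewrite -subr_eq0 -det0; apply/eqP; ring.
Qed.

Lemma hexagon_psd_size_gt3 (R : realType) (q : nat -> 'rV[R]_2) (l : nat)
    (A B : nat -> 'M[R]_l) : ccw_hexagon q ->
  (forall i, (i < 6)%N -> psdmx (A i)) -> (forall j, (j < 6)%N -> psdmx (B j)) ->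
  (forall i j, (i < 6)%N -> (j < 6)%N -> \tr (A i *m B j) = hex_slack q j i) ->
  (3 < l)%N.
Proof.
move=> cq psdA psdB trAB; rewrite ltnNge; apply/negP => l3.
have AB0 i j : (i < 6)%N -> (j < 6)%N -> (i == j) || (i == next6 j) ->
    A i *m B j = 0.
  move=> i6 j6 ij; apply: psdmx_mul_eq0; rewrite ?trAB //; auto.
  by case/orP: ij => /eqP ->; rewrite ?hex_slack_start ?hex_slack_end.
have BA0 i j : (i < 6)%N -> (j < 6)%N -> (i == j) || (i == next6 j) ->
    B j *m A i = 0.
  by move=> i6 j6 ij; apply: psdmx_mulC0; rewrite ?AB0; auto.
have ABn0 i j : (i < 6)%N -> (j < 6)%N -> i != j -> i != next6 j ->
    A i *m B j != 0.
  move=> i6 j6 ij inj; apply: contraTneq (hex_slack_gt0 cq j6 i6 ij inj) => AB.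
  by rewrite -trAB // AB mxtrace0 ltxx.
have BAn0 i j : (i < 6)%N -> (j < 6)%N -> i != j -> i != next6 j ->
    B j *m A i != 0.
  move=> i6 j6 ij inj; apply: contraNneq (ABn0 _ _ i6 j6 ij inj) => BA.
  by apply/eqP; apply: psdmx_mulC0 BA; auto.
have An0 i : (i < 6)%N -> A i != 0.
  move=> i6; have [j [j6 ij inj]] : exists j, [/\ (j < 6)%N, i != j & i != next6 j].
    by exists (next6 i); split; case: i i6 => [|[|[|[|[|[|]]]]]].
  by apply: contraNneq (ABn0 _ _ i6 j6 ij inj) => ->; rewrite mul0mx.
have Bn0 j : (j < 6)%N -> B j != 0.
  move=> j6; have [i [i6 ij inj]] : exists i, [/\ (i < 6)%N, i != j & i != next6 j].
    by exists (next6 (next6 j)); split; case: j j6 => [|[|[|[|[|[|]]]]]].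
  by apply: contraNneq (ABn0 _ _ i6 j6 ij inj) => ->; rewrite mulmx0.
(* Vertex [next6 j] lies on the edges [j] and [next6 j]. The vertex after it lies on the second but
   not on the first, so its factor plays the part of [C]. *)
have rA j : (j < 6)%N -> (\rank (A (next6 j)) <= 1)%N.
  move=> j6; have j'6 := next6_lt j6; have j''6 := next6_lt j'6.
  apply: (psdmx_rank_le1 l3 (psdA _ j'6) (psdB _ j'6) (psdB _ j6)
    (AB0 _ _ j'6 j'6 _) (AB0 _ _ j'6 j6 _) (BA0 _ _ j''6 j'6 _)
    (BAn0 _ _ j''6 j6 _ _) (Bn0 _ j'6)); rewrite ?eqxx ?orbT //;
    by case: j j6 {j'6 j''6} => [|[|[|[|[|[|]]]]]].
have rB j : (j < 6)%N -> (\rank (B j) <= 1)%N.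
  move=> j6; have j'6 := next6_lt j6; have j''6 := next6_lt j'6.
  apply: (psdmx_rank_le1 l3 (psdB _ j6) (psdA _ j'6) (psdA _ j6)
    (BA0 _ _ j'6 j6 _) (BA0 _ _ j6 j6 _) (AB0 _ _ j'6 j'6 _)
    (ABn0 _ _ j6 j'6 _ _) (An0 _ j'6)); rewrite ?eqxx ?orbT //;
    by case: j j6 {j'6 j''6} => [|[|[|[|[|[|]]]]]].
have rA' i : (i < 6)%N -> (\rank (A i) <= 1)%N.
  move=> i6; have [j j6 ->] : exists2 j, (j < 6)%N & i = next6 j; last exact: rA.
    by case: i i6 => [|i] i6; [exists 5|exists i; case: i i6 => [|[|[|[|[|]]]]]].
have [a aE] : exists a : nat -> 'rV[R]_l,
    forall i, (i < 6)%N -> A i = (a i)^T *m a i.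
  have H i : exists x : 'rV[R]_l, (i < 6)%N -> A i = x^T *m x.
    have [i6|] := ltnP i 6; last by exists 0.
    by have [x] := psdmx_rank1P (psdA i i6) (rA' i i6); exists x.
  by exists (fun i => sval (cid (H i))) => i; case: cid.
have [b bE] : exists b : nat -> 'rV[R]_l,
    forall j, (j < 6)%N -> B j = (b j)^T *m b j.
  have H j : exists x : 'rV[R]_l, (j < 6)%N -> B j = x^T *m x.
    have [j6|] := ltnP j 6; last by exists 0.
    by have [x] := psdmx_rank1P (psdB j j6) (rB j j6); exists x.
  by exists (fun j => sval (cid (H j))) => j; case: cid.
pose h i j := (a i *m (b j)^T) 0 0.
have h2 i j : (i < 6)%N -> (j < 6)%N -> hex_slack q j i = h i j ^+ 2.
  by move=> i6 j6; rewrite -trAB // aE // bE // sqr_trace_rank1.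
have h0 i j : (i < 6)%N -> (j < 6)%N -> (i == j) || (i == next6 j) -> h i j = 0.
  move=> i6 j6 ij; apply/eqP; rewrite -sqrf_eq0 -h2 //.
  by case/orP: ij => /eqP ->; rewrite ?hex_slack_start ?hex_slack_end.
have hn0 i j : (i < 6)%N -> (j < 6)%N -> i != j -> i != next6 j -> h i j != 0.
  move=> i6 j6 ij inj; rewrite -sqrf_eq0 -h2 //.
  by rewrite gt_eqF // hex_slack_gt0.
(* The 4 x 4 minors of [h] and of its entrywise square vanish; both have only
   three terms, and [x = y + z], [x^2 = y^2 + z^2] forces [y z = 0]. *)
have detS := hex_slack_minor q; rewrite !h2 // in detS.
have deth := det4_dot l3 (fun i j => erefl (h i j)) (h0 0 0 isT isT isT)
  (h0 1 1 isT isT isT) (h0 2 2 isT isT isT) (h0 3 3 isT isT isT)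
  (h0 1 0 isT isT isT) (h0 2 1 isT isT isT) (h0 3 2 isT isT isT).
have : 2 * (h 1%N 2%N * h 2%N 0%N * h 0%N 3%N * h 3%N 1%N)
         * (h 1%N 2%N * h 2%N 3%N * h 3%N 0%N * h 0%N 1%N) = 0.
  have := congr1 (fun x => x ^+ 2) deth; rewrite sqrrD !exprMn.
  by move: detS; lra.
by apply/eqP; rewrite !mulf_neq0 ?pnatr_eq0 ?hn0.
Qed.

(** * Upper bound *)

Definition row4 (R : realType) (x y z w : R) : 'rV[R]_4 :=
  \row_k [:: x; y; z; w]`_k.

Lemma row4_dot (R : realType) (x y z w x' y' z' w' : R) :
  (row4 x y z w *m (row4 x' y' z' w')^T) 0 0 = x * x' + y * y' + z * z' + w * w'.
Proof. by rewrite !mxE !big_ord_recr big_ord0 /= !mxE /= add0r. Qed.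

Lemma ord2P (k : 'I_2) : k = 0 \/ k = 1.
Proof. by case: k => [[|[|//]] lt2]; [left|right]; apply: val_inj. Qed.

(* In homogeneous coordinates [q 5 + z q 2] is the point of the segment between
   [q 0] and [q 3] through which the axis of the octahedron passes. *)
Lemma hexagon_octahedron_lift (R : realType) (q : nat -> 'rV[R]_2) :
  ccw_hexagon q ->
  exists s t z : R, [/\ 0 < s, 0 < t, 0 < z,
    1 + z = s ^+ 2 * tri q 1 3 4 + t ^+ 2 * tri q 0 1 4
  & forall k, q 5%N 0 k + z * q 2%N 0 k =
      s ^+ 2 * tri q 1 3 4 * q 0%N 0 k +
      t ^+ 2 * tri q 0 1 4 * q 3%N 0 k].
Proof.
move=> cq.
have c023 : 0 < tri q 0 2 3 by apply: cq.
have c134 : 0 < tri q 1 3 4 by apply: cq.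
have c014 : 0 < tri q 0 1 4 by apply: cq.
have c235 : 0 < tri q 2 3 5 by apply: cq.
have c025 : 0 < tri q 0 2 5 by apply: cq.
have c035 : 0 < tri q 0 3 5 by apply: cq.
(* The ratios come from the affine dependence of [q 0], [q 2], [q 3], [q 5], scaled so that [q 5]
   has coefficient 1. The further divisions by [tri q 1 3 4] and [tri q 0 1 4] match the weights of
   [q 0] and [q 3] in the base. *)
exists (Num.sqrt (tri q 2 3 5 / tri q 0 2 3 / tri q 1 3 4)).
exists (Num.sqrt (tri q 0 2 5 / tri q 0 2 3 / tri q 0 1 4)).
exists (tri q 0 3 5 / tri q 0 2 3).
have n023 := lt0r_neq0 c023; have n134 := lt0r_neq0 c134.
have n014 := lt0r_neq0 c014.
split; rewrite ?sqrtr_gt0 ?divr_gt0 // !sqr_sqrtr ?divr_ge0 ?ltW // ?divr_gt0 //.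
  rewrite !divfK // -[1](@divff _ (tri q 0 2 3)) // -!mulrDl.
  by congr (_ / _); rewrite /tri; coords; ring.
move=> k; rewrite !divfK //.
have -> : q 5%N 0 k = q 5%N 0 k * tri q 0 2 3 / tri q 0 2 3.
  by rewrite mulfK.
rewrite ![_ / _ * q _ 0 k]mulrAC -!mulrDl; congr (_ / _).
by have [->|->] := ord2P k; rewrite /tri; coords; ring.
Qed.

Lemma mxtrace_rank1D (R : realType) (k : nat) (a b c : 'rV[R]_k) (r x y : R) :
  \tr (r *: (a^T *m a) *m (x *: (b^T *m b) + y *: (c^T *m c))) =
  r * (x * ((a *m b^T) 0 0) ^+ 2 + y * ((a *m c^T) 0 0) ^+ 2).
Proof.
rewrite -scalemxAl mulmxDr -!scalemxAr mxtraceZ mxtraceD !mxtraceZ.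
by rewrite !sqr_trace_rank1.
Qed.

(* [a i] and [b j], [c j] are the square root factors of the vertices of the
   octahedron and of its two facets through the edge [j]. *)
Lemma hexagon_psd_size4 (R : realType) (q : nat -> 'rV[R]_2) :
  ccw_hexagon q ->
  exists A B : nat -> 'M[R]_4,
    [/\ forall i, (i < 6)%N -> psdmx (A i), forall j, (j < 6)%N -> psdmx (B j) &
        forall i j, (i < 6)%N -> (j < 6)%N ->
          \tr (A i *m B j) = hex_slack q j i].
Proof.
move=> cq; have [s [t [z [s0 t0 z0 zE q5E]]]] := hexagon_octahedron_lift cq.
have xE : q 5%N 0 0 = s ^+ 2 * tri q 1 3 4 * q 0%N 0 0 + t ^+ 2 * tri q 0 1 4 * q 3%N 0 0
    - z * q 2%N 0 0 by rewrite -q5E addrK.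
have yE : q 5%N 0 1 = s ^+ 2 * tri q 1 3 4 * q 0%N 0 1 + t ^+ 2 * tri q 0 1 4 * q 3%N 0 1
    - z * q 2%N 0 1 by rewrite -q5E addrK.
have {}zE : z = s ^+ 2 * tri q 1 3 4 + t ^+ 2 * tri q 0 1 4 - 1.
  by rewrite -zE addrC addKr.
(* For the base these are the inverses of the coefficients in the affine dependence of [q 0], [q 1],
   [q 3], [q 4]. The apexes [q 2] and [q 5] have weights [z] and 1, and 4 makes up for their root
   entries [2 * s] and [2 * t]. *)
pose r := nth 0 [:: (tri q 1 3 4)^-1; (tri q 0 3 4)^-1; (4 * z)^-1;
                   (tri q 0 1 4)^-1; (tri q 0 1 3)^-1; 4^-1].
(* With these weights absorbed, the base dependence becomes [a 0 + a 3 = a 1 + a 4]; the apexes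
   satisfy [a 2 + a 5 = 2 (s a 0 + t a 3)]. *)
pose a := nth 0 [:: row4 1 0 0 0; row4 0 0 1 0; row4 s t 0 (-1);
                   row4 0 1 0 0; row4 1 1 (-1) 0; row4 s t 0 1].
(* Each weight is forced by a vertex that lies on only one of the two facets; for the edges 0 and 3
   this vertex is an apex, and [d] divides out the square of [t] or [s] that it brings in. *)
pose x := nth 0 [:: tri q 0 1 5; tri q 0 1 4 * tri q 1 2 3; tri q 0 1 3 * tri q 2 3 4;
                   tri q 3 4 5; tri q 1 3 4 * tri q 0 4 5; tri q 0 3 4 * tri q 0 1 5].
pose b := nth 0 [:: row4 0 1 0 t; row4 0 1 0 t; row4 1 0 0 s;
                   row4 1 0 1 s; row4 1 0 1 (-s); row4 0 1 1 (-t)].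
pose y := nth 0 [:: z * tri q 0 1 2; tri q 1 3 4 * tri q 0 1 2; tri q 0 3 4 * tri q 1 2 3;
                   z * tri q 2 3 4; tri q 0 1 4 * tri q 3 4 5; tri q 0 1 3 * tri q 0 4 5].
pose c := nth 0 [:: row4 0 1 0 (-t); row4 1 0 0 s; row4 1 0 1 s;
                   row4 1 0 1 (-s); row4 0 1 1 (-t); row4 0 1 0 (-t)].
pose d := nth 0 [:: t ^- 2; 1; 1; s ^- 2; 1; 1].
exists (fun i => r i *: ((a i)^T *m a i)).
exists (fun j => d j *: (x j *: ((b j)^T *m b j) + y j *: ((c j)^T *m c j))).
have r_ge0 i : (i < 6)%N -> 0 <= r i.
  by case: i => [|[|[|[|[|[|//]]]]]] _; rewrite /r /= invr_ge0 ?mulr_ge0 ?ler0n// ltW ?cq.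
have x_ge0 j : (j < 6)%N -> 0 <= x j.
  by case: j => [|[|[|[|[|[|//]]]]]] _; rewrite /x /= ?mulr_ge0// ltW ?cq.
have y_ge0 j : (j < 6)%N -> 0 <= y j.
  by case: j => [|[|[|[|[|[|//]]]]]] _; rewrite /y /= ?mulr_ge0// ltW ?cq.
have d_gt0 j : (j < 6)%N -> 0 < d j.
  by case: j => [|[|[|[|[|[|//]]]]]] _; rewrite /d /= ?invr_gt0 ?exprn_gt0.
split.
- by move=> i i6; apply: psdmxZ; [exact: r_ge0|exact: psdmx_rank1].
- move=> j j6; apply: psdmxZ; first by rewrite ltW ?d_gt0.
  by apply: psdmx_sumD; apply: psdmxZ; rewrite ?x_ge0 ?y_ge0 //; exact: psdmx_rank1.
have sn0 := lt0r_neq0 s0; have tn0 := lt0r_neq0 t0.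
have rn0 i : (i < 6)%N -> r i != 0.
  by case: i => [|[|[|[|[|[|//]]]]]] _; rewrite /r /= invr_neq0 ?mulf_neq0 ?pnatr_eq0// lt0r_neq0 ?cq.
move=> i j i6 j6; rewrite -scalemxAr mxtraceZ mxtrace_rank1D.
(* Cancelling [r i] and [d j] leaves 36 polynomial identities once [q 5] and [z] are eliminated. *)
apply: (mulfI (invr_neq0 (rn0 _ i6))).
apply: (mulfI (invr_neq0 (lt0r_neq0 (d_gt0 _ j6)))).
rewrite mulrCA mulKf ?(lt0r_neq0 (d_gt0 _ j6)) // mulKf ?rn0 // /hex_slack.
case: i i6 => [|[|[|[|[|[|//]]]]]] _; case: j j6 => [|[|[|[|[|[|//]]]]]] _.
all: rewrite /r /a /x /b /y /c /d /= !row4_dot ?invrK ?invr1.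
all: rewrite /tri /orient in xE yE zE |- *.
all: rewrite ?xE ?yE ?zE.
all: by coords; ring.
Qed.

(** * Convex hulls and their extreme points *)

Lemma dotr_sum (R : realType) (n m : nat) (c : 'rV[R]_n) (w : 'I_m -> R)
    (s : 'I_m -> 'rV[R]_n) :
  dotr c (\sum_i w i *: s i) = \sum_i w i * dotr c (s i).
Proof.
rewrite /dotr; under eq_bigr do rewrite summxE mulr_sumr.
rewrite exchange_big /=; apply: eq_bigr => i _; rewrite mulr_sumr.
by apply: eq_bigr => k _; rewrite mxE mulrCA.
Qed.

Lemma affine_sum (R : realType) (n m : nat) (c : 'rV[R]_n) (d : R)
    (w : 'I_m -> R) (s : 'I_m -> 'rV[R]_n) : \sum_i w i = 1 ->
  d - dotr c (\sum_i w i *: s i) = \sum_i w i * (d - dotr c (s i)).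
Proof.
move=> w1; rewrite [RHS](eq_bigr _ (fun i _ => mulrBr _ _ _)).
by rewrite sumrB -mulr_suml w1 mul1r dotr_sum.
Qed.

Lemma conv_hull_gen (R : realType) (n m : nat) (s : 'I_m -> 'rV[R]_n) i :
  conv_hull s (s i).
Proof.
exists (fun k => (k == i)%:R); split.
- by move=> k; rewrite ler0n.
- by rewrite (bigD1 i) //= eqxx big1 ?addr0 // => k /negPf ->.
- rewrite (bigD1 i) //= eqxx scale1r big1 ?addr0 // => k /negPf ->.
  by rewrite scale0r.
Qed.

Lemma conv_hull_convex (R : realType) (n m : nat) (s : 'I_m -> 'rV[R]_n)
    (y z : 'rV[R]_n) (t : R) : 0 <= t <= 1 ->
  conv_hull s y -> conv_hull s z -> conv_hull s (t *: y + (1 - t) *: z).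
Proof.
move=> /andP[t0 t1] [a [a0 a1 ->]] [b [b0 b1 ->]].
exists (fun i => t * a i + (1 - t) * b i); split.
- by move=> i; rewrite addr_ge0 ?mulr_ge0 ?subr_ge0.
- by rewrite big_split /= -!mulr_sumr a1 b1 !mulr1 addrC subrK.
- rewrite !scaler_sumr -big_split /=; apply: eq_bigr => i _.
  by rewrite [RHS]scalerDl !scalerA.
Qed.

(** If [s i] is a proper combination of two points of the hull, mixing their weights gives it a
    weight [g i] on itself. Weight 1 forces both points to be [s i]; with a smaller weight, [s i] is
    a convex combination of the other generators. *)
Lemma conv_hull_vertex_or_drop (R : realType) (n m : nat)
    (s : 'I_m.+1 -> 'rV[R]_n) (i : 'I_m.+1) :
  vertices (conv_hull s) (s i) \/ conv_hull s = conv_hull (s \o lift i).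
Proof.
have [eqP|neqP] := pselect (conv_hull s = conv_hull (s \o lift i)); first by right.
left; split; first exact: conv_hull_gen.
move=> y z t [a [a0 a1 ->]] [b [b0 b1 ->]] t0 t1 sE.
pose g k := t * a k + (1 - t) * b k.
have g0 k : 0 <= g k.
  by rewrite addr_ge0 // mulr_ge0 ?subr_ge0 // ltW.
have g1 : \sum_k g k = 1.
  by rewrite big_split /= -!mulr_sumr a1 b1 !mulr1 addrC subrK.
have gE : s i = \sum_k g k *: s k.
  rewrite [LHS]sE !scaler_sumr -big_split /=; apply: eq_bigr => k _.
  by rewrite [RHS]scalerDl !scalerA.
have le1 (w : 'I_m.+1 -> R) : (forall k, 0 <= w k) -> \sum_k w k = 1 ->
    w i <= 1 /\ (w i = 1 -> \sum_k w k *: s k = s i).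
  move=> w0; rewrite (bigD1_ord i) //= => w1.
  have sw : 0 <= \sum_(k < m) w (lift i k) by apply: sumr_ge0.
  split; first by rewrite -w1 lerDl.
  move=> wi; move: w1; rewrite wi => /eqP; rewrite -subr_eq0 addrAC subrr add0r.
  rewrite psumr_eq0 // => /allP w0'.
  rewrite (bigD1_ord i) //= wi scale1r big1 ?addr0 // => k _.
  by have /eqP -> := w0' k (mem_index_enum _); rewrite scale0r.
have [ai1 aE] := le1 a a0 a1; have [bi1 bE] := le1 b b0 b1.
have [gi1 _] := le1 g g0 g1.
move: gi1; rewrite le_eqVlt => /orP[/eqP gi1|gi1].
  have [aib bib] : a i = 1 /\ b i = 1 by move: gi1; rewrite /g; split; nra.
  by rewrite aE // bE.
case: neqP; apply/seteqP; split => x [w [w0 w1 ->]].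
- pose v k := w i * (g (lift i k) / (1 - g i)) + w (lift i k).
  have gi : 0 < 1 - g i by rewrite subr_gt0.
  have gi' := lt0r_neq0 gi.
  exists v; split.
  + by move=> k; rewrite addr_ge0 // mulr_ge0 // divr_ge0 // ltW.
  + rewrite big_split /= -mulr_sumr -mulr_suml.
    have -> : \sum_(k < m) g (lift i k) = 1 - g i.
      by rewrite -g1 [in RHS](bigD1_ord i) //= [RHS]addrC addKr.
    by rewrite divff // mulr1 -w1 (bigD1_ord i).
  + rewrite (bigD1_ord i) //=.
    have -> : s i = \sum_(k < m) (g (lift i k) / (1 - g i)) *: s (lift i k).
      apply: (scalerI gi'); rewrite scaler_sumr scalerBl scale1r.
      rewrite {1}gE (bigD1_ord i) //= [LHS]addrC addKr; apply: eq_bigr => k _.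
      by rewrite scalerA mulrC divfK.
    rewrite scaler_sumr -big_split /=; apply: eq_bigr => k _.
    by rewrite [RHS]scalerDl scalerA.
- exists (fun k => if unlift i k is Some k' then w k' else 0); split.
  + by move=> k; case: unlift.
  + rewrite (bigD1_ord i) //= unlift_none add0r -w1.
    by apply: eq_bigr => k _; rewrite liftK.
  + rewrite (bigD1_ord i) //= unlift_none scale0r add0r.
    by apply: eq_bigr => k _; rewrite liftK.
Qed.

Lemma polytope_vertices (R : realType) (n : nat) (P : set 'rV[R]_n) :
  polytope P -> exists (m : nat) (s : 'I_m -> 'rV[R]_n),
    (forall i, vertices P (s i)) /\ P = conv_hull s.
Proof.
case=> m [s PE]; elim: m s PE => [|m IHm] s PE.
  by exists 0%N, s; split=> // -[].
have [allv|/existsNP[i nvi]] := pselect (forall i, vertices P (s i)).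
  by exists m.+1, s.
have [vi|PE'] := conv_hull_vertex_or_drop s i; first by rewrite -PE in vi.
by apply: (IHm (s \o lift i)); rewrite -PE'.
Qed.

(** Merging [v] and [w] into [z], which convexity keeps in [P], reduces this to the segment from [u]
    to [z]. Zero coefficients and repeated points are allowed, so segments count as degenerate
    triangles. *)
Lemma vertex_conv3 (R : realType) (n m : nat) (s : 'I_m -> 'rV[R]_n)
    (P : set 'rV[R]_n) (x u v w : 'rV[R]_n) (a b c : R) : P = conv_hull s ->
  vertices P x -> P u -> P v -> P w -> 0 <= a -> 0 <= b -> 0 <= c ->
  a + b + c = 1 -> x = a *: u + b *: v + c *: w -> [\/ x = u, x = v | x = w].
Proof.
move=> PE [Px xP] Pu Pv Pw a0 b0 c0 abc xE.
have [aE|an0] := eqVneq a 0.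
  rewrite aE add0r in abc; rewrite aE scale0r add0r in xE.
  have cE : c = 1 - b by rewrite -abc addrC addKr.
  have [bE|bn0] := eqVneq b 0.
    by apply: Or33; rewrite xE cE bE subr0 scale0r scale1r add0r.
  have [b1|bn1] := eqVneq b 1.
    by apply: Or32; rewrite xE cE b1 subrr scale0r scale1r addr0.
  apply: Or32; have [] // := xP v w b Pv Pw; rewrite ?lt_def ?bn0 //.
    by rewrite eq_sym bn1 -abc lerDl.
  by rewrite -cE.
have [a1|an1] := eqVneq a 1.
  have [b0' c0'] : b = 0 /\ c = 0 by split; lra.
  by apply: Or31; rewrite xE a1 b0' c0' !scale0r scale1r !addr0.
have a_lt1 : a < 1 by rewrite lt_neqAle an1 -abc -addrA lerDl addr_ge0.
have a1' : 1 - a != 0 by rewrite gt_eqF // subr_gt0.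
pose z := (b / (1 - a)) *: v + (1 - b / (1 - a)) *: w.
have Pz : P z.
  rewrite PE; apply: conv_hull_convex; rewrite -?PE //.
  apply/andP; split; first by apply: divr_ge0; rewrite ?subr_ge0 // ltW.
  by rewrite ler_pdivrMr ?subr_gt0 // mul1r; lra.
apply: Or31; have [] // := xP u z a Pu Pz; rewrite ?lt_def ?an0 //.
rewrite scalerDr !scalerA xE -addrA; congr (_ + (_ + _)); congr (_ *: _).
  by rewrite mulrC divfK.
by rewrite mulrBr mulr1 [_ * (b / _)]mulrC divfK // -abc; ring.
Qed.

(** * Angular order of the vertices of a planar polytope *)

Lemma orient_barycentric (R : realType) (u v w x : 'rV[R]_2) :
  orient u v w != 0 ->
  x = (orient x v w / orient u v w) *: u + (orient u x w / orient u v w) *: v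
      + (orient u v x / orient u v w) *: w.
Proof.
move=> n0; suff xE k : x 0 k = orient x v w / orient u v w * u 0 k +
    orient u x w / orient u v w * v 0 k + orient u v x / orient u v w * w 0 k.
  by apply/rowP => k; rewrite !mxE.
have E (p r : R) : p / orient u v w * r = p * r / orient u v w by field.
rewrite !E -!mulrDl -[LHS](mulfK n0); congr (_ / _).
by have [->|->] := ord2P k; coords; ring.
Qed.

Lemma orient_barycentric1 (R : realType) (u v w x : 'rV[R]_2) :
  orient x v w + orient u x w + orient u v x = orient u v w.
Proof. by coords; ring. Qed.

Lemma vertex_notin_triangle (R : realType) (m : nat) (s : 'I_m -> 'rV[R]_2)
    (x u v w : 'rV[R]_2) :
  vertices (conv_hull s) x -> vertices (conv_hull s) u ->
  vertices (conv_hull s) v -> vertices (conv_hull s) w ->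
  0 < orient u v w -> 0 <= orient x v w -> 0 <= orient u x w ->
  0 <= orient u v x -> [\/ x = u, x = v | x = w].
Proof.
move=> Vx [Pu _] [Pv _] [Pw _] uvw xvw uxw uvx.
have n0 := lt0r_neq0 uvw.
apply: (vertex_conv3 erefl Vx Pu Pv Pw _ _ _ _ (orient_barycentric x n0)).
- by rewrite divr_ge0 // ltW.
- by rewrite divr_ge0 // ltW.
- by rewrite divr_ge0 // ltW.
- by rewrite -!mulrDl orient_barycentric1 divff.
Qed.

Lemma vertices_orient_neq0 (R : realType) (m : nat) (s : 'I_m -> 'rV[R]_2)
    (u v w : 'rV[R]_2) :
  vertices (conv_hull s) u -> vertices (conv_hull s) v ->
  vertices (conv_hull s) w ->
  u != v -> v != w -> u != w -> orient u v w != 0.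
Proof.
move=> Vu Vv Vw uv vw uw; apply/negP => /eqP uvw.
have [k kP] : exists k, v 0 k - u 0 k != 0.
  apply/existsP; apply: contraNT uv; rewrite negb_exists => /forallP uv0.
  apply/eqP/rowP => k; have := uv0 k; rewrite negbK subr_eq0 => /eqP.
  by [].
(* The position of [w] on the line, 0 at [u] and 1 at [v]; whichever of the three points lies in the
   middle fails to be extreme. *)
pose l := (w 0 k - u 0 k) / (v 0 k - u 0 k).
have wE i : w 0 i = (1 - l) * u 0 i + l * v 0 i.
  apply: (mulfI kP); rewrite mulrDr ![_ * (_ * _ 0 i)]mulrA mulrBr mulr1.
  rewrite /l [(v 0 k - u 0 k) * (_ / _)]mulrC divfK //.
  move: uvw; have [->|->] := ord2P i; have [->|->] := ord2P k;
    by coords => uvw; lra.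
have [[Pu _] [Pv _] [Pw _]] := And3 Vu Vv Vw.
have [l0|l0] := ltP l 0.
  have l1 : 1 - l != 0 by rewrite gt_eqF //; lra.
  have uE : u = (1 - l)^-1 *: w + (- l / (1 - l)) *: v + 0 *: w.
    by apply/rowP => i; rewrite !mxE wE; field.
  case: (vertex_conv3 erefl Vu Pw Pv Pw _ _ _ _ uE) => //.
  - by rewrite invr_ge0; lra.
  - by apply: divr_ge0; lra.
  - by field.
  - by move/eqP; rewrite (negPf uw).
  - by move/eqP; rewrite (negPf uv).
  - by move/eqP; rewrite (negPf uw).
have [l1|l1] := ltP 1 l.
  have ln0 : l != 0 by rewrite gt_eqF //; lra.
  have vE : v = l^-1 *: w + (1 - l^-1) *: u + 0 *: u.
    by apply/rowP => i; rewrite !mxE wE; field.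
  case: (vertex_conv3 erefl Vv Pw Pu Pu _ _ _ _ vE) => //.
  - by rewrite invr_ge0; lra.
  - by rewrite subr_ge0 invf_le1; lra.
  - by field.
  - by move/eqP; rewrite (negPf vw).
  - by move/eqP; rewrite eq_sym (negPf uv).
  - by move/eqP; rewrite eq_sym (negPf uv).
have wE' : w = (1 - l) *: u + l *: v + 0 *: u.
  by apply/rowP => i; rewrite !mxE wE; ring.
case: (vertex_conv3 erefl Vw Pu Pv Pu _ _ _ _ wE') => //.
- by rewrite subr_ge0.
- by ring.
- by move/eqP; rewrite eq_sym (negPf uw).
- by move/eqP; rewrite eq_sym (negPf vw).
- by move/eqP; rewrite eq_sym (negPf uw).
Qed.

(** For general points this fails, as two turns around [o] can exceed a half-turn. Here that would
    put [o] into the triangle [a b c]. *)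
Lemma orient_trans (R : realType) (m : nat) (s : 'I_m -> 'rV[R]_2)
    (o a b c : 'rV[R]_2) :
  vertices (conv_hull s) o -> vertices (conv_hull s) a ->
  vertices (conv_hull s) b -> vertices (conv_hull s) c ->
  o != a -> o != b -> o != c -> a != c ->
  0 < orient o a b -> 0 < orient o b c -> 0 < orient o a c.
Proof.
move=> Vo Va Vb Vc oa ob oc ac oab obc.
rewrite lt_def (vertices_orient_neq0 Vo Va Vc) //= leNgt; apply/negP => oac.
have aoc : 0 < orient a o c by rewrite orient_swap oppr_gt0.
have abo : 0 < orient a b o by rewrite -orient_rot.
have abc : 0 < orient a b c.
  by rewrite -(orient_barycentric1 a b c o); apply: addr_gt0 => //; apply: addr_gt0.
by case: (vertex_notin_triangle Vo Va Vb Vc abc (ltW obc) (ltW aoc) (ltW abo));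
  apply/eqP.
Qed.

(** Otherwise [b], seen from [o] between [a] and [c], would lie in the triangle [o a c]. *)
Lemma orient_convex (R : realType) (m : nat) (s : 'I_m -> 'rV[R]_2)
    (o a b c : 'rV[R]_2) :
  vertices (conv_hull s) o -> vertices (conv_hull s) a ->
  vertices (conv_hull s) b -> vertices (conv_hull s) c ->
  o != b -> a != b -> b != c -> a != c ->
  0 < orient o a b -> 0 < orient o b c -> 0 < orient o a c ->
  0 < orient a b c.
Proof.
move=> Vo Va Vb Vc ob ab bc ac oab obc oac.
rewrite lt_def (vertices_orient_neq0 Va Vb Vc) //= leNgt; apply/negP => abc.
have bac : 0 < orient b a c by rewrite orient_swap oppr_gt0.
case: (vertex_notin_triangle Vb Vo Va Vc oac (ltW bac) (ltW obc) (ltW oab));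
  apply/eqP => //; by rewrite eq_sym.
Qed.

(** The other five vertices are sorted by angle around [u0], with a weak inequality because sorting
    needs a total relation; [orient_convex] then handles the triples that avoid [u0]. *)
Lemma hexagon_enum (R : realType) (m : nat) (s : 'I_m -> 'rV[R]_2)
 :
  (vertices (conv_hull s) #= `I_6)%card ->
  exists q : nat -> 'rV[R]_2, ccw_hexagon q /\
    forall x, vertices (conv_hull s) x <-> exists2 i, (i < 6)%N & x = q i.
Proof.
set V := vertices _; move=> /card_set_bijP[g [gI ginj gsurj]].
have [f fP] : exists f : nat -> 'rV[R]_2,
    forall i, (i < 6)%N -> V (f i) /\ g (f i) = i.
  have H i : exists x, (i < 6)%N -> V x /\ g x = i.
    have [i6|] := ltnP i 6; last by exists 0.
    by have [x Vx gx] := gsurj i i6; exists x.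
  by exists (fun i => sval (cid (H i))) => i; case: cid.
have fV i : (i < 6)%N -> V (f i) by move=> /fP[].
have fsurj x : V x -> exists2 i, (i < 6)%N & f i = x.
  move=> Vx; have gx6 := gI x Vx; exists (g x) => //.
  by apply: ginj; rewrite ?inE; [exact: fV|exact: Vx|case: (fP _ gx6)].
have fI i j : (i < 6)%N -> (j < 6)%N -> f i = f j -> i = j.
  by move=> /fP[_ {2}<-] /fP[_ {2}<-] ->.
pose u0 := f 0%N; pose rest := [seq f i | i <- iota 1 5].
pose leT a b := 0 <= orient u0 a b.
pose l := sort leT rest; pose q := nth 0 (u0 :: l).
have Vu0 : V u0 by exact: fV.
have restV x : x \in rest -> V x /\ u0 != x.
  move=> /mapP[i]; rewrite mem_iota => /andP[i0 i6] ->; split; first exact: fV.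
  by apply: contraTneq i0 => /(fI 0%N i isT i6) <-.
have leT_total : total leT.
  move=> a b; rewrite /leT; have [//|lt0] := leP 0 (orient u0 a b).
  by rewrite orient_rot orient_swap -orient_rot oppr_ge0 ltW.
have leT_trans : {in mem rest & &, transitive leT}.
  move=> b a c /restV[Vb ub] /restV[Va ua] /restV[Vc uc]; rewrite /leT => ab bc.
  have [->//|nab] := eqVneq a b; have [<-//|nbc] := eqVneq b c.
  have [<-|nac] := eqVneq a c; first by rewrite orient_eqr.
  apply/ltW/(orient_trans Vu0 Va Vb Vc) => //.
    by rewrite lt_def ab (vertices_orient_neq0 Vu0 Va Vb).
  by rewrite lt_def bc (vertices_orient_neq0 Vu0 Vb Vc).
have sz : size l = 5 by rewrite size_sort size_map size_iota.
have uniq_rest : uniq rest.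
  rewrite map_inj_in_uniq ?iota_uniq // => i j; rewrite !mem_iota.
  by move=> /andP[_ i6] /andP[_ j6]; apply: fI.
have mem_l x : (x \in l) = (x \in rest) by rewrite mem_sort.
have uniq_q : uniq (u0 :: l).
  rewrite /= sort_uniq uniq_rest andbT mem_l.
  by apply/negP => /restV[_]; rewrite eqxx.
have qV i : (i < 6)%N -> V (q i).
  case: i => [//|i] i6.
  have /restV[] // : q i.+1 \in rest.
  by rewrite -mem_l /q /=; apply: mem_nth; rewrite sz.
have q_neq i j : (i < j)%N -> (j < 6)%N -> q i != q j.
  move=> ij j6; rewrite nth_uniq //= ?sz ?(ltn_trans ij) //.
  by rewrite ltn_eqF.
have q0 i j : (0 < i)%N -> (i < j)%N -> (j < 6)%N -> 0 < orient u0 (q i) (q j).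
  case: i j => [//|i] [//|j] _ ij j6; rewrite lt_def.
  have i6 := ltn_trans ij j6.
  rewrite (vertices_orient_neq0 Vu0 (qV _ i6) (qV _ j6)) ?(q_neq 0%N) ?q_neq //=.
  have allr : all (mem rest) l by apply/allP => x; rewrite mem_l.
  apply: (sorted_ltn_nth_in leT_trans 0 allr (sort_sorted leT_total rest)) => //.
    by rewrite inE sz; exact: i6.
  by rewrite inE sz.
exists q; split.
  case=> [|i] j k ij jk k6; rewrite /tri; first exact: q0.
  have j6 := ltn_trans jk k6; have i6 := ltn_trans ij j6.
  have ik := ltn_trans ij jk; have j0 : (0 < j)%N by apply: leq_trans ij.
  by apply: (orient_convex Vu0 (qV _ i6) (qV _ j6) (qV _ k6) (q_neq 0%N j j0 j6)
    (q_neq _ _ ij j6) (q_neq _ _ jk k6) (q_neq _ _ ik k6)); apply: q0.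
move=> x; split => [/fsurj[i i6 <-]|[i i6 ->]]; last exact: qV.
have : f i \in u0 :: l.
  rewrite inE mem_l; case: i i6 => [|i] i6; first by rewrite eqxx.
  by rewrite map_f ?orbT // mem_iota.
by move=> /(nthP 0)[k]; rewrite /= sz => k6 <-; exists k.
Qed.

Lemma conv_hull_sub (R : realType) (n m k : nat) (s : 'I_m -> 'rV[R]_n)
    (q : 'I_k -> 'rV[R]_n) :
  (forall j, conv_hull s (q j)) -> conv_hull q `<=` conv_hull s.
Proof.
move=> qs x [w [w0 w1 ->]].
pose a j := sval (cid (qs j)).
have aP j : [/\ forall i, 0 <= a j i, \sum_i a j i = 1 & q j = \sum_i a j i *: s i].
  by rewrite /a; case: cid.
exists (fun i => \sum_j w j * a j i); split.
- by move=> i; apply: sumr_ge0 => j _; rewrite mulr_ge0 //; case: (aP j).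
- rewrite exchange_big /= -[RHS]w1; apply: eq_bigr => j _.
  by rewrite -mulr_sumr; case: (aP j) => _ -> _; rewrite mulr1.
- under [RHS]eq_bigr do rewrite scaler_suml.
  rewrite exchange_big /=; apply: eq_bigr => j _.
  case: (aP j) => _ _ {1}->; rewrite scaler_sumr.
  by apply: eq_bigr => i _; rewrite scalerA.
Qed.

(** * Affine independence and the facets of the hexagon *)

Lemma dotr2 (R : realType) (c x : 'rV[R]_2) :
  dotr c x = c 0 0 * x 0 0 + c 0 1 * x 0 1.
Proof.
rewrite /dotr !big_ord_recl big_ord0 addr0; congr (_ + c 0 _ * x 0 _);
  exact: val_inj.
Qed.

(** The identity in the proof comes from the affine dependence of four points of the plane: one
    value off the line [u v] determines the function. *)
Lemma affine_orient (R : realType) (c : 'rV[R]_2) (d : R) (u v w x : 'rV[R]_2) :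
  d - dotr c u = 0 -> d - dotr c v = 0 ->
  (d - dotr c x) * orient u v w = (d - dotr c w) * orient u v x.
Proof.
move=> u0 v0; suff E : (d - dotr c u) * orient v w x - (d - dotr c v) * orient u w x
    + (d - dotr c w) * orient u v x - (d - dotr c x) * orient u v w = 0.
  by apply/eqP; rewrite eq_sym -subr_eq0 -E u0 v0 !mul0r subrr add0r.
by rewrite !dotr2; coords; ring.
Qed.

Definition edge_normal (R : realType) (u v : 'rV[R]_2) : 'rV[R]_2 :=
  \row_k (if k == 0 then v 0 1 - u 0 1 else u 0 0 - v 0 0).

Definition edge_offset (R : realType) (u v : 'rV[R]_2) : R :=
  (v 0 1 - u 0 1) * u 0 0 - (v 0 0 - u 0 0) * u 0 1.

Lemma edge_ineq (R : realType) (u v x : 'rV[R]_2) :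
  edge_offset u v - dotr (edge_normal u v) x = orient u v x.
Proof.
have e0 : edge_normal u v 0 0 = v 0 1 - u 0 1 by rewrite mxE.
have e1 : edge_normal u v 0 1 = u 0 0 - v 0 0 by rewrite mxE.
by rewrite dotr2 e0 e1 /edge_offset; coords; ring.
Qed.

Lemma has_aff_indep_leq (R : realType) (n : nat) (A : set 'rV[R]_n) (l m : nat) :
  (l <= m)%N -> has_aff_indep A m -> has_aff_indep A l.
Proof.
move=> /subnKC <-; elim: (m - l)%N => [|k IHk]; first by rewrite addn0.
rewrite addnS => -[s [sA si]]; apply: IHk.
exists (fun i => s (widen_ord (leqnSn _) i)); split=> // a a1 aE i.
pose b (j : 'I_(l + k).+1) := if insub (val j) is Some i then a i else 0.
have bw j : b (widen_ord (leqnSn _) j) = a j by rewrite /b /= valK.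
have bm : b ord_max = 0 by rewrite /b insubF //= ltnn.
rewrite -bw; apply: si; rewrite big_ord_recr /= bm.
  by rewrite addr0 -[RHS]a1; apply: eq_bigr => j _; rewrite bw.
by rewrite scale0r addr0 -[RHS]aE; apply: eq_bigr => j _; rewrite bw.
Qed.

Lemma has_aff_indep2P (R : realType) (n : nat) (A : set 'rV[R]_n) :
  has_aff_indep A 2 <-> exists u v, [/\ A u, A v & u != v].
Proof.
split=> [[s [sA si]]|[u [v [Au Av uv]]]].
  exists (s 0), (s 1); split=> //; apply/negP => /eqP s01.
  have := si (fun i => if i == 0 then 1 else -1).
  rewrite !big_ord_recl !big_ord0 /= !addr0 subrr.
  rewrite (_ : lift ord0 ord0 = 1); last exact: val_inj.
  rewrite -s01 scale1r scaleN1r subrr => /(_ erefl erefl 0) /eqP.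
  by rewrite oner_eq0.
exists (fun i : 'I_2 => if i == 0 then u else v); split=> [i|a]; first by case: ifP.
rewrite !big_ord_recl !big_ord0 /= !addr0.
set a0 := a _; set a1 := a (lift _ _) => a01.
have -> : a1 = - a0 by apply/eqP; rewrite -addr_eq0 addrC a01.
rewrite scaleNr -scalerBr => /eqP; rewrite scaler_eq0 subr_eq0 (negPf uv) orbF.
move=> /eqP a00 i; have [->|->] := ord2P i; first exact: a00.
have -> : a 1 = a1 by congr a; apply: val_inj.
by rewrite a00 add0r in a01.
Qed.

Lemma has_aff_indep3P (R : realType) (A : set 'rV[R]_2) :
  has_aff_indep A 3 <-> exists u v w, [/\ A u, A v, A w & orient u v w != 0].
Proof.
split=> [[s [sA si]]|[u [v [w [Au Av Aw uvw]]]]].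
  pose t k := s (inord k).
  have tE (a : nat -> R) : \sum_(i < 3) a i *: s i =
      a 0%N *: t 0%N + a 1%N *: t 1%N + a 2%N *: t 2%N.
    rewrite !big_ord_recr big_ord0 /= add0r; congr (_ *: s _ + _ *: s _ + _ *: s _);
      by apply: val_inj; rewrite /= inordK.
  exists (t 0%N), (t 1%N), (t 2%N); split; try exact: sA.
  apply/negP => /eqP o0.
  have si' (a : nat -> R) : a 0%N + a 1%N + a 2%N = 0 ->
      a 0%N *: t 0%N + a 1%N *: t 1%N + a 2%N *: t 2%N = 0 -> forall i, (i < 3)%N -> a i = 0.
    move=> a0 aE i i3; apply: (si (fun k => a k) _ _ (Ordinal i3)).
      by rewrite !big_ord_recr big_ord0 /= add0r.
    by rewrite tE.
  (* Collinear points satisfy a relation whose coefficients are differences of their [k]-th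
     coordinates; independence kills the last one, so [t 0] and [t 1] agree in coordinate [k]. *)
  have coord k : t 0%N 0 k = t 1%N 0 k.
    pose a i := if i is 0 then t 1%N 0 k - t 2%N 0 k else
                if i is 1 then t 2%N 0 k - t 0%N 0 k else t 0%N 0 k - t 1%N 0 k.
    apply/eqP; rewrite -subr_eq0; apply/eqP; apply: (si' a _ _ 2%N) => //.
      by rewrite /a /=; ring.
    have aE j : a 0%N * t 0%N 0 j + a 1%N * t 1%N 0 j + a 2%N * t 2%N 0 j = 0.
      rewrite /a /=; move: o0.
      by have [->|->] := ord2P k; have [->|->] := ord2P j; coords => o0; lra.
    by apply/rowP => j; rewrite !mxE aE.
  have t01 : t 0%N = t 1%N by apply/rowP => k; apply: coord.
  have := si' (fun i => if i is 0 then 1 else if i is 1 then -1 else 0).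
  rewrite /= t01 scale1r scaleN1r scale0r !subrr !addr0.
  by move=> /(_ erefl erefl 0%N isT)/eqP; rewrite oner_eq0.
exists (fun i : 'I_3 => nth 0 [:: u; v; w] i); split=> [i|a].
  by case: i => [[|[|[|//]]] i3].
rewrite !big_ord_recr !big_ord0 /= !add0r.
set a0 := a _; set a1 := a (widen_ord _ _); set a2 := a _ => a012 aE.
have aE' k : a0 * u 0 k + a1 * v 0 k + a2 * w 0 k = 0.
  by have := congr1 (fun x : 'rV_2 => x 0 k) aE; rewrite !mxE.
(* A dependence is preserved by the affine function [orient x y]; with [x] and [y] among the three
   points, a single coefficient survives. *)
have oE x y : a0 * orient x y u + a1 * orient x y v + a2 * orient x y w = 0.
  have -> : a0 * orient x y u + a1 * orient x y v + a2 * orient x y w =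
      (y 0 0 - x 0 0) * (a0 * u 0 1 + a1 * v 0 1 + a2 * w 0 1 - (a0 + a1 + a2) * x 0 1)
    - (y 0 1 - x 0 1) * (a0 * u 0 0 + a1 * v 0 0 + a2 * w 0 0 - (a0 + a1 + a2) * x 0 0).
    by coords; ring.
  by rewrite !aE' a012; ring.
have := oE u v; have := oE v w; have := oE w u.
rewrite !orient_eql !orient_eqr !mulr0 !addr0 !add0r -(orient_rot u v w).
rewrite (orient_rot w u v) => /eqP + /eqP + /eqP.
rewrite !mulf_eq0 !(negPf uvw) !orbF => /eqP a1E /eqP a0E /eqP a2E.
case=> [[|[|[|//]]] i3].
- by rewrite -[RHS]a0E; congr a; apply: val_inj.
- by rewrite -[RHS]a1E; congr a; apply: val_inj.
- by rewrite -[RHS]a2E; congr a; apply: val_inj.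
Qed.

Lemma aff_dim_uniq (R : realType) (n : nat) (A : set 'rV[R]_n) (d e : nat) :
  aff_dim A d -> aff_dim A e -> d = e.
Proof.
move=> [hd nd] [he ne]; have [lt|lt|//] := ltngtP d e.
  by case: nd; apply: has_aff_indep_leq he.
by case: ne; apply: has_aff_indep_leq hd.
Qed.

Definition hex_face (R : realType) (q : nat -> 'rV[R]_2) (P : set 'rV[R]_2)
    (j : nat) : set 'rV[R]_2 :=
  face_of P (edge_normal (q j) (q (next6 j))) (edge_offset (q j) (q (next6 j))).

Lemma hex_affine_ge0 (R : realType) (q : nat -> 'rV[R]_2) (P : set 'rV[R]_2)
    (c : 'rV[R]_2) (d : R) :
  P = conv_hull (fun i : 'I_6 => q i) ->
  (forall i, (i < 6)%N -> 0 <= d - dotr c (q i)) -> valid_ineq P c d.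
Proof.
move=> -> cd0 x [w [w0 w1 ->]]; rewrite affine_sum //.
by apply: sumr_ge0 => i _; rewrite mulr_ge0 ?cd0.
Qed.

Lemma hex_slack_ge0 (R : realType) (q : nat -> 'rV[R]_2) (j i : nat) :
  ccw_hexagon q -> (j < 6)%N -> (i < 6)%N -> 0 <= hex_slack q j i.
Proof.
move=> cq j6 i6; have [->|ij] := eqVneq i j; first by rewrite hex_slack_start.
have [->|inj] := eqVneq i (next6 j); first by rewrite hex_slack_end.
by rewrite ltW // hex_slack_gt0.
Qed.

Lemma hex_vertex_neq (R : realType) (q : nat -> 'rV[R]_2) (i k : nat) :
  ccw_hexagon q -> (i < k)%N -> (k < 6)%N -> q i != q k.
Proof.
move=> cq ik k6; apply/negP => /eqP qik.
have := @hex_slack_gt0 _ q i k cq (ltn_trans ik k6) k6.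
have := @hex_slack_gt0 _ q k i cq k6 (ltn_trans ik k6).
rewrite /hex_slack /tri qik orient_eql -qik orient_eql ltxx.
rewrite (ltn_eqF ik) (gtn_eqF ik) /=.
by case: i k ik k6 {qik} => [|[|[|[|[|i]]]]] [|[|[|[|[|[|k]]]]]] // _ _;
  do ?[by move/(_ isT isT)|move=> _].
Qed.

Lemma hex_edge_facet (R : realType) (q : nat -> 'rV[R]_2) (P : set 'rV[R]_2)
    (j : nat) : ccw_hexagon q -> P = conv_hull (fun i : 'I_6 => q i) ->
  aff_dim P 2 -> (j < 6)%N ->
  facet_ineq P (edge_normal (q j) (q (next6 j))) (edge_offset (q j) (q (next6 j))).
Proof.
move=> cq PE P2 j6; have j'6 := next6_lt j6.
have Pq i : (i < 6)%N -> P (q i).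
  by move=> i6; rewrite PE; apply: (conv_hull_gen (fun i : 'I_6 => q i) (Ordinal i6)).
split.
  by apply: (hex_affine_ge0 PE) => i i6; rewrite edge_ineq; apply: hex_slack_ge0.
exists 1%N; split=> //; split.
  apply/has_aff_indep2P; exists (q j), (q (next6 j)); split.
  - by split; [exact: Pq|rewrite edge_ineq orient_eql].
  - by split; [exact: Pq|rewrite edge_ineq orient_eqr].
  - have [->|j5] := eqVneq j 5; first by rewrite eq_sym (hex_vertex_neq cq).
    have nj : next6 j = j.+1 by case: (j) j5 => [|[|[|[|[|[|]]]]]].
    by rewrite nj in j'6 *; rewrite (hex_vertex_neq cq).
move=> /has_aff_indep3P[u [v [w [[_ u0] [_ v0] [_ w0]]]]].
have m6 := next6_lt j'6; pose m := next6 (next6 j).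
have om : 0 < hex_slack q j m.
  by apply: hex_slack_gt0 => //; rewrite /m; case: (j) j6 => [|[|[|[|[|[|]]]]]].
have := affine_orient w (q m) u0 v0; rewrite w0 mul0r edge_ineq => /eqP.
by rewrite mulf_eq0 (gt_eqF om) /= => /eqP ->; rewrite eqxx.
Qed.

(** A point of the face is a combination of vertices on the face, so a face of dimension one
    contains two of them. They are neighbours: a diagonal has vertices strictly on both sides, where
    the function would take opposite signs. *)
Lemma hex_facet_edge (R : realType) (q : nat -> 'rV[R]_2) (P : set 'rV[R]_2)
    (c : 'rV[R]_2) (d : R) : ccw_hexagon q ->
  P = conv_hull (fun i : 'I_6 => q i) -> aff_dim P 2 -> facet_ineq P c d ->
  exists j l, [/\ (j < 6)%N, 0 < l &
    forall x, d - dotr c x = l * orient (q j) (q (next6 j)) x].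
Proof.
move=> cq PE P2 [valid [e [Pe Fe]]].
have e1 : e = 1%N by have [] := aff_dim_uniq P2 Pe.
rewrite e1 in Fe; have [/has_aff_indep2P[y [z [Fy Fz yz]]] nF3] := Fe.
have Pq i : (i < 6)%N -> P (q i).
  by move=> i6; rewrite PE; apply: (conv_hull_gen (fun i : 'I_6 => q i) (Ordinal i6)).
have cd0 i : (i < 6)%N -> 0 <= d - dotr c (q i) by move=> i6; apply/valid/Pq.
have zero_of x : face_of P c d x -> exists w : 'I_6 -> R, [/\ \sum_i w i = 1,
    x = \sum_i w i *: q i & forall i : 'I_6, w i != 0 -> d - dotr c (q i) = 0].
  rewrite /face_of PE => -[[w [w0 w1 ->]]]; rewrite affine_sum // => /eqP.
  rewrite psumr_eq0 => [/allP E|i _]; last by rewrite mulr_ge0 // cd0.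
  exists w; split=> // i wi; have := E i (mem_index_enum _).
  by rewrite /= mulf_eq0 (negPf wi) => /eqP.
have single (i : 'I_6) x : face_of P c d x ->
    (forall k : 'I_6, d - dotr c (q k) = 0 -> k = i) -> x = q i.
  move=> /zero_of[w [w1 -> w0]] only.
  have wk (k : 'I_6) : k != i -> w k = 0.
    by move=> ki; apply: contraNeq ki => /w0/only ->.
  have wi : w i = 1 by rewrite -w1 (bigD1 i) //= big1 ?addr0.
  by rewrite (bigD1 i) //= wi scale1r big1 ?addr0 // => k /wk ->; rewrite scale0r.
have [i [k [ik k6 qi qk]]] : exists i k, [/\ (i < k)%N, (k < 6)%N,
    d - dotr c (q i) = 0 & d - dotr c (q k) = 0].
  have [i qi] : exists i : 'I_6, d - dotr c (q i) = 0.
    have [w [w1 _ w0]] := zero_of y Fy; apply: contrapT => no.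
    move: w1; rewrite big1 => [/eqP|i _]; first by rewrite eq_sym oner_eq0.
    by apply: contrapT => /eqP/w0 wi; apply: no; exists i.
  have [k qk ki] : exists2 k : 'I_6, d - dotr c (q k) = 0 & k != i.
    apply: contrapT => no; case/negP: yz; apply/eqP.
    have only (k : 'I_6) : d - dotr c (q k) = 0 -> k = i.
      by move=> qk; apply: contrapT => /eqP ki; apply: no; exists k.
    by rewrite (single i y) // (single i z).
  have [lt|lt|/val_inj E] := ltngtP i k; last by rewrite E eqxx in ki.
    by exists i, k.
  by exists k, i.
have pos m : (m < 6)%N -> orient (q i) (q k) (q m) != 0 -> 0 < d - dotr c (q m).
  move=> m6 om; rewrite lt_def cd0 // andbT; apply/negP => /eqP qm; apply: nF3.
  apply/has_aff_indep3P; exists (q i), (q k), (q m); split=> //; split=> //;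
    apply: Pq => //; exact: ltn_trans k6.
have finish j : (j < 6)%N -> d - dotr c (q j) = 0 -> d - dotr c (q (next6 j)) = 0 ->
    0 < d - dotr c (q (next6 (next6 j))) ->
    exists j l, [/\ (j < 6)%N, 0 < l &
      forall x, d - dotr c x = l * orient (q j) (q (next6 j)) x].
  move=> j6 qj qj' qm; have j'6 := next6_lt j6; have m6 := next6_lt j'6.
  have om : 0 < hex_slack q j (next6 (next6 j)).
    by apply: hex_slack_gt0 => //; case: (j) j6 => [|[|[|[|[|[|]]]]]].
  exists j, ((d - dotr c (q (next6 (next6 j)))) / hex_slack q j (next6 (next6 j))).
  split=> //; first by rewrite divr_gt0.
  move=> x; have n0 := lt0r_neq0 om; apply: (mulIf n0).
  by rewrite (affine_orient _ x qj qj') mulrAC divfK.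
have i6 := ltn_trans ik k6.
have [kE|nk] := eqVneq k i.+1.
  have ni : next6 i = k.
    by rewrite kE; case: (i) kE k6 => [|[|[|[|[|[|]]]]]] // ->.
  have n6 := next6_lt k6; apply: (finish i); rewrite ?ni //; apply: pos => //.
  rewrite -ni lt0r_neq0 //; apply: hex_slack_gt0; rewrite ?ni //.
    by rewrite -ni; case: (i) i6 => [|[|[|[|[|[|]]]]]].
  by case: (k) k6 => [|[|[|[|[|[|]]]]]].
have o1 : orient (q i) (q k) (q i.+1) < 0.
  have i1k : (i.+1 < k)%N by rewrite ltn_neqAle eq_sym nk.
  by rewrite orient_rot orient_swap -orient_rot oppr_lt0; apply: cq.
have i16 : (i.+1 < 6)%N by apply: leq_ltn_trans k6.
have contra m : (m < 6)%N -> 0 < orient (q i) (q k) (q m) -> False.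
  move=> m6 om; have := affine_orient (q m) (q i.+1) qi qk.
  have := pos m m6 (lt0r_neq0 om); have := pos _ i16 (ltr0_neq0 o1).
  move: om o1; clear; nra.
(* To the left of the diagonal lies [q 0] if [i] is positive and [q 5] otherwise, except that 0 and
   5 form the closing edge. *)
have [i0|i0] := posnP i; last first.
  by case: (contra 0%N) => //; rewrite orient_rot orient_rot; apply: cq.
have [k5|k5] := eqVneq k 5.
  subst i k; exact: (finish 5%N isT qk qi (pos 1%N isT (ltr0_neq0 o1))).
case: (contra 5%N) => //; apply: cq => //.
by rewrite ltn_neqAle k5 -ltnS.
Qed.

Lemma hex_face_inj (R : realType) (q : nat -> 'rV[R]_2) (P : set 'rV[R]_2)
    (j k : nat) : ccw_hexagon q -> (forall i, (i < 6)%N -> P (q i)) ->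
  (j < 6)%N -> (k < 6)%N -> hex_face q P j = hex_face q P k -> j = k.
Proof.
move=> cq Pq j6 k6 E.
have on i : (i < 6)%N -> hex_face q P j (q i) -> (i == k) || (i == next6 k).
  move=> i6; rewrite E => -[_]; rewrite edge_ineq => qi0.
  apply: contraPT qi0; rewrite negb_or => /andP[ik ik'].
  by apply/eqP/lt0r_neq0/hex_slack_gt0.
have := on j j6; have := on _ (next6_lt j6); rewrite /hex_face /face_of /=.
rewrite !edge_ineq orient_eql orient_eqr.
move=> /(_ (conj (Pq _ (next6_lt j6)) erefl)) + /(_ (conj (Pq _ j6) erefl)).
case: j j6 {E on} => [|[|[|[|[|[|//]]]]]] _;
  by case: k k6 => [|[|[|[|[|[|//]]]]]].
Qed.

Lemma hexagon_slack_matrix (R : realType) (q : nat -> 'rV[R]_2)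
    (P : set 'rV[R]_2) : ccw_hexagon q -> P = conv_hull (fun i : 'I_6 => q i) ->
  aff_dim P 2 -> (forall x, vertices P x <-> exists2 i, (i < 6)%N & x = q i) ->
  slack_matrix P (\matrix_(i < 6, j < 6) hex_slack q j i).
Proof.
move=> cq PE P2 VE.
have Pq i : (i < 6)%N -> P (q i) by move=> i6; have [|] := (VE (q i)).2; first by exists i.
exists (fun i : 'I_6 => q i), (fun j : 'I_6 => edge_normal (q j) (q (next6 j))),
  (fun j : 'I_6 => edge_offset (q j) (q (next6 j))); split.
- split.
    move=> i k qik; apply: val_inj; have [lt|lt|//] := ltngtP i k.
      by have := hex_vertex_neq cq lt (ltn_ord k); rewrite qik eqxx.
    by have := hex_vertex_neq cq lt (ltn_ord i); rewrite qik eqxx.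
  apply/seteqP; split=> [x [i _ <-]|x /VE[i i6 ->]]; first by apply/VE; exists i.
  by exists (Ordinal i6).
- by move=> j; apply: hex_edge_facet.
- move=> F [c [d [cd ->]]]; have [j [l [j6 l0 E]]] := hex_facet_edge cq PE P2 cd.
  have FE : face_of P c d = hex_face q P j.
    apply/seteqP; split=> x [Px]; rewrite ?edge_ineq ?E => x0; split; rewrite ?edge_ineq ?E //.
      by move: x0 => /eqP; rewrite mulf_eq0 (gt_eqF l0) => /eqP.
    by rewrite x0 mulr0.
  exists (Ordinal j6); split=> // k kE; apply: val_inj.
  by apply: (hex_face_inj cq Pq j6 (ltn_ord k)); rewrite -FE.
- by move=> i j; rewrite mxE edge_ineq.
Qed.

Theorem theorem3p4 (R : realType) (P : set 'rV[R]_2)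
    (P_polytope : polytope P) (P_full : full_dimensional P)
    (P_hexagon : (vertices P #= `I_6)%card) :
  polytope_psd_rank P 4.
Proof.
have [m [s [sV PE]]] := polytope_vertices P_polytope.
have := P_hexagon; rewrite {1}PE => /hexagon_enum[q [cq]]; rewrite -PE => VE.
have Pq i : (i < 6)%N -> P (q i).
  by move=> i6; have [|] := (VE (q i)).2; first by exists i.
have PEq : P = conv_hull (fun i : 'I_6 => q i).
  apply/seteqP; split.
    rewrite [X in X `<=` _]PE; apply: conv_hull_sub => k.
    have /VE[i i6 ->] := sV k.
    exact: (conv_hull_gen (fun i : 'I_6 => q i) (Ordinal i6)).
  by rewrite [X in _ `<=` X]PE; apply: conv_hull_sub => i; rewrite -PE; apply: Pq.
have slackq := hexagon_slack_matrix cq PEq P_full VE.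
split; first by exists 6, 6, (\matrix_(i < 6, j < 6) hex_slack q j i).
move=> p f M [v [c [d [[vinj vV] cdP facets ME]]]].
(* [g] and [h] locate the given rows and columns in the hexagon, [h] together with the positive
   scaling of each column. *)
have [g gP] : exists g : 'I_p -> nat, forall i, (g i < 6)%N /\ v i = q (g i).
  have H i : exists k, (k < 6)%N /\ v i = q k.
    by have /VE[k] : vertices P (v i) by [rewrite -vV; exists i|]; exists k.
  by exists (fun i => sval (cid (H i))) => i; case: cid.
have [h hP] : exists h : 'I_f -> nat * R, forall j,
    [/\ ((h j).1 < 6)%N, 0 < (h j).2 & forall x, d j - dotr (c j) x =
      (h j).2 * orient (q (h j).1) (q (next6 (h j).1)) x].
  have H j : exists y : nat * R, [/\ (y.1 < 6)%N, 0 < y.2 & forall x,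
      d j - dotr (c j) x = y.2 * orient (q y.1) (q (next6 y.1)) x].
    have [k [l E]] := hex_facet_edge cq PEq P_full (cdP j).
    by exists (k, l).
  by exists (fun i => sval (cid (H i))) => i; case: cid.
have MhE i j : M i j = (h j).2 * hex_slack q (h j).1 (g i).
  by rewrite ME; have [_ _ ->] := hP j; have [_ ->] := gP i.
split.
  have [A [B [psdA psdB AB]]] := hexagon_psd_size4 cq.
  exists (fun i => A (g i)), (fun j => (h j).2 *: B (h j).1); split.
  - by move=> i; apply: psdA; case: (gP i).
  - by move=> j; have [j6 l0 _] := hP j; apply: psdmxZ; [exact: ltW|exact: psdB].
  - move=> i j; have [j6 _ _] := hP j; have [i6 _] := gP i.
    by rewrite MhE -scalemxAr mxtraceZ AB.
move=> l [A [B [psdA psdB AB]]].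
(* The inverse labellings are option-valued because ['I_p] and ['I_f] come without a default
   element; [None] is sent to the factor 0. *)
have [g' g'P] : exists g' : nat -> option 'I_p, forall k, (k < 6)%N ->
    exists2 i, g' k = Some i & g i = k.
  have H k : exists y : option 'I_p, (k < 6)%N -> exists2 i, y = Some i & g i = k.
    have [k6|] := ltnP k 6; last by exists None.
    have [i _ viE] : range v (q k) by rewrite vV; apply/VE; exists k.
    exists (Some i) => _; exists i => //; have [i6 vi] := gP i.
    move: viE; rewrite vi => E; have [lt|lt|//] := ltngtP (g i) k.
      by have := hex_vertex_neq cq lt k6; rewrite E eqxx.
    by have := hex_vertex_neq cq lt i6; rewrite E eqxx.
  by exists (fun k => sval (cid (H k))) => k; case: cid.
have [h' h'P] : exists h' : nat -> option 'I_f, forall k, (k < 6)%N ->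
    exists2 j, h' k = Some j & (h j).1 = k.
  have H k : exists y : option 'I_f, (k < 6)%N -> exists2 j, y = Some j & (h j).1 = k.
    have [k6|] := ltnP k 6; last by exists None.
    have fk : facet P (hex_face q P k).
      by exists (edge_normal (q k) (q (next6 k))), (edge_offset (q k) (q (next6 k)));
        split=> //; apply: hex_edge_facet.
    have [j [FE _]] := facets _ fk; exists (Some j) => _; exists j => //.
    have [j6 l0 E] := hP j; apply: (hex_face_inj cq Pq) => //; rewrite FE.
    apply/seteqP; split=> x [Px]; rewrite ?edge_ineq ?E => x0; split;
      rewrite ?edge_ineq ?E //; first by rewrite x0 mulr0.
    by move: x0 => /eqP; rewrite mulf_eq0 (gt_eqF l0) => /eqP.
  by exists (fun k => sval (cid (H k))) => k; case: cid.
apply: (@hexagon_psd_size_gt3 _ q l (fun k => if g' k is Some i then A i else 0)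
  (fun k => if h' k is Some j then (h j).2^-1 *: B j else 0)) => //.
- by move=> k /g'P[i -> _]; apply: psdA.
- move=> k /h'P[j -> _]; have [_ l0 _] := hP j.
  by apply: psdmxZ => //; rewrite invr_ge0 ltW.
- move=> i j /g'P[a -> ai] /h'P[b -> bj]; have [_ l0 _] := hP b.
  by rewrite -scalemxAr mxtraceZ -AB MhE ai bj mulKf // lt0r_neq0.
Qed.
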